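(* Let $d \geq 1$. Then for any integers $k,\ell$ with $0 \leq k \leq \ell \leq d-k-1$, there exists an infinite family $\{\mathcal{P}_1,\mathcal{P}_2,\ldots\}$ of integral convex polytopes in $\mathbb{R}^d$ of dimension $d$ such that for all $i \neq j$: (i) for $t=1,\ldots,k$, $i(\mathcal{P}_i,t)=i(\mathcal{P}_j,t)$; (ii) for $t=1,\ldots,\ell$, $i^*(\mathcal{P}_i,t)=i^*(\mathcal{P}_j,t)$; (iii) $i(\mathcal{P}_i,k+1) \neq i(\mathcal{P}_j,k+1)$ and $i^*(\mathcal{P}_i,\ell+1)\neq i^*(\mathcal{P}_j,\ell+1)$.
   Context: An integral convex polytope is a convex polytope all of whose vertices have integer coordinates. For an integral convex polytope $\mathcal{P}\subset\mathbb{R}^d$ with boundary $\partial\mathcal{P}$ and integer $n\ge1$, $i(\mathcal{P},n)=|n\mathcal{P}\cap\mathbb{Z}^d|$ and $i^*(\mathcal{P},n)=|n(\mathcal{P}\setminus\partial\mathcal{P})\cap\mathbb{Z}^d|$, where $n\mathcal{P}=\{n\alpha:\alpha\in\mathcal{P}\}$. *)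

(* Defs.v *)
From HB Require Import structures.
From mathcomp Require Import all_boot all_order all_algebra finmap.
From mathcomp Require Import all_classical all_reals all_analysis.

Set Implicit Arguments.
Unset Strict Implicit.
Unset Printing Implicit Defensive.

Import Order.TTheory GRing.Theory Num.Theory.
Import numFieldNormedType.Exports.

Local Open Scope classical_set_scope.
Local Open Scope ring_scope.

Section Polytopes.
Context {R : realType} {d : nat}.
Implicit Types (A P : set 'rV[R]_d) (v : 'rV[R]_d) (n : nat).

Definition convex_hull A : set 'rV[R]_d :=
  smallest (fun B => convex_set (B : set (convex_lmodType 'rV[R]_d))) A.

Definition convex_polytope P : Prop :=
  exists2 S : set 'rV[R]_d, finite_set S & P = convex_hull S.

(* The vertices of a polytope are its extreme points. *)
Definition vertex P v : Prop :=
  P v /\ forall x y (t : R), P x -> P y -> 0 < t < 1 ->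
    v = t *: x + (1 - t) *: y -> x = v /\ y = v.

Definition integer_points : set 'rV[R]_d := [set x | x \is a mxOver Num.int].

Definition integral_convex_polytope P : Prop :=
  convex_polytope P /\ vertex P `<=` integer_points.

(* Over a field of characteristic 0, closure under the lines through two points
   characterizes the (possibly empty) affine subspaces. *)
Definition affine_set A : Prop :=
  forall x y (t : R), A x -> A y -> A (t *: x + (1 - t) *: y).

Definition affine_hull A : set 'rV[R]_d := smallest affine_set A.

(* The empty set has no dimension in this sense. *)
Definition has_dimension A n : Prop :=
  exists (p : 'rV[R]_d) (U : {vspace 'rV[R]_d}),
    affine_hull A = [set p + u | u in [set` U]] /\ (\dim U)%VS = n.

Definition boundary A : set 'rV[R]_d := closure A `\` interior A.

Definition dilate n A : set 'rV[R]_d := [set n%:R *: x | x in A].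

(* [fset_set] sends infinite sets to the empty one; polytopes are bounded, so
   only finite sets are counted below when P is a polytope. *)
Definition ehrhart P n : nat := #|` fset_set (dilate n P `&` integer_points)|.

Definition ehrhart_interior P n : nat :=
  #|` fset_set (dilate n (P `\` boundary P) `&` integer_points)|.

End Polytopes.

(* Main.v *)
(** Let w = d - l - k > 0 and N = w M, and let P_M be the simplex with vertices
    0, the unit vectors e_j for j <> k, and the vector with coordinate N at
    k (coordinates numbered from 0), 1 at j < k, -1 at k < j < k + (d - l), and
    0 at the remaining l - k places.  A lattice point of t P_M whose barycentric
    coordinates are integers corresponds to a lattice point of t times the
    standard simplex, and the number of these does not depend on M.  For any
    other lattice point the coordinate at k is r/N modulo 1 for some 0 < r < N,
    and integrality forces the barycentric coordinates to be at least 1 - r/N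
    (k times), r/N (d - l times) and 0, or 1 for interior points (l - k times);
    these bounds add up to k + r/M, resp. l + r/M.  So such points only appear
    from dilation k + 1, resp. l + 1, on, and at that first dilation there is
    exactly one for each r <= M with r < N, resp. each r < M. *)
Require Import Defs.
From HB Require Import structures.
From mathcomp Require Import all_boot all_order all_algebra finmap.
From mathcomp Require Import all_classical all_reals all_analysis.
From mathcomp Require Import ring lra zify.

Set Implicit Arguments.
Unset Strict Implicit.
Unset Printing Implicit Defensive.

Import Order.TTheory GRing.Theory Num.Theory.
Import numFieldNormedType.Exports.

Local Open Scope classical_set_scope.
Local Open Scope ring_scope.

Lemma continuous_bigsum {R : realType} (T : topologicalType) (I : Type)
    (s : seq I) (f : I -> T -> R) :
  (forall i, continuous (f i)) -> continuous (fun x => \sum_(i <- s) f i x).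
Proof.
move=> fc x; rewrite /continuous_at.
by apply: (cvg_big add_continuous) => i _; exact: fc.
Qed.

(** * Convex sets, extreme points and affine hulls *)

Section Convexity.
Context {R : realType} {d : nat}.
Implicit Types (C S : set 'rV[R]_d) (x y : 'rV[R]_d).

Lemma convex_setE C :
  convex_set (C : set (convex_lmodType 'rV[R]_d)) <->
  forall x y (t : R), 0 <= t <= 1 -> C x -> C y -> C (t *: x + (1 - t) *: y).
Proof.
split=> [cC x y t /andP[t0 t1] /mem_set Cx /mem_set Cy | cC x y t].
  exact/set_mem/(cC x y (Itv01 t0 t1) Cx Cy).
move=> /set_mem Cx /set_mem Cy; apply/mem_set.
by apply: (cC x y t%:num) => //; apply/andP; split.
Qed.

(** As [0] lies in [C], the weights need only sum to at most 1: the missing weight goes to [0].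
    Induction splits off one term and rescales the rest by [(1 - f i)^-1]; if [f i] is 1, all other
    weights vanish. *)
Lemma convex_set_sum C (I : Type) (s : seq I) (f : I -> R) (v : I -> 'rV[R]_d) :
  convex_set (C : set (convex_lmodType 'rV[R]_d)) -> C 0 ->
  (forall i, C (v i)) -> (forall i, 0 <= f i) -> \sum_(i <- s) f i <= 1 ->
  C (\sum_(i <- s) f i *: v i).
Proof.
move=> /convex_setE cC C0 Cv; elim: s f => [|i s IHs] f f0.
  by rewrite !big_nil.
rewrite !big_cons => f1.
have s0 : 0 <= \sum_(j <- s) f j by apply: sumr_ge0.
have [fi1|fi1] := ltP (f i) 1; last first.
  have s00 : \sum_(j <- s) f j = 0 by lra.
  have fi : f i = 1 by lra.
  have : C (\sum_(j <- s) f j *: v j) by apply: IHs => //; rewrite s00.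
  have -> : \sum_(j <- s) f j *: v j = 0; last first.
    by rewrite fi scale1r addr0.
  elim: s {IHs f1 s0 fi fi1 i} s00 => [|i s IHs]; first by rewrite !big_nil.
  rewrite !big_cons => fs0.
  have s0 : 0 <= \sum_(j <- s) f j by apply: sumr_ge0.
  have fi0 := f0 i.
  have -> : f i = 0 by lra.
  by rewrite scale0r add0r IHs //; lra.
have fiN0 : 1 - f i != 0 by rewrite subr_eq0 gt_eqF.
have -> : \sum_(j <- s) f j *: v j =
    (1 - f i) *: \sum_(j <- s) ((1 - f i)^-1 * f j) *: v j.
  rewrite scaler_sumr; apply: eq_bigr => j _.
  by rewrite scalerA mulrA divff // mul1r.
apply: cC => //; first by rewrite f0 ltW.
apply: IHs => [j|]; first by rewrite mulr_ge0 // invr_ge0; lra.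
by rewrite -mulr_sumr mulrC ler_pdivrMr ?mul1r; lra.
Qed.

Lemma convex_hull_convex S :
  convex_set (convex_hull S : set (convex_lmodType 'rV[R]_d)).
Proof.
apply/convex_setE => x y t t01 Sx Sy B [cB SB].
by move: (cB) => /convex_setE; apply=> //; [apply: Sx|apply: Sy].
Qed.

(* Deleting an extreme point from a convex set leaves a convex set. *)
Lemma vertex_convex_hull S : vertex (convex_hull S) `<=` S.
Proof.
move=> v [Sv ext]; apply: contrapT => nSv.
suff /(_ v Sv)[_ /(_ erefl)] : convex_hull S `<=` convex_hull S `\ v by [].
apply: smallest_sub; last first.
  move=> x Sx; split; first exact: sub_gen_smallest.
  by move=> /= xv; apply: nSv; rewrite -xv.
apply/convex_setE => x y t t01 [Sx xv] [Sy yv]; split.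
  by move: (@convex_hull_convex S) => /convex_setE; apply.
move=> /= txy; case/andP: t01; rewrite le_eqVlt => /orP[/eqP t0 _|t0].
  by apply: yv; rewrite /= -txy -t0 scale0r subr0 scale1r add0r.
rewrite le_eqVlt => /orP[/eqP t1|t1].
  by apply: xv; rewrite /= -txy t1 scale1r subrr scale0r addr0.
by apply: xv; apply: (ext x y t Sx Sy _ (esym txy)).1; rewrite t0 t1.
Qed.

Lemma setD_boundary S : S `\` boundary S = S°.
Proof.
apply/seteqP; split=> [x [Sx nbx]|x Sx].
  by apply: contrapT => nx; apply: nbx; split => //; apply: subset_closure.
by split; [apply: interior_subset|case].
Qed.

(** An affine set through 0 is a linear subspace: lines through 0 give scaling, and [y + z] is the
    midpoint of [2 y] and [2 z]. *)
Lemma affine_hull_setT S :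
  S 0 -> (forall x, exists (I : finType) (f : I -> R) (v : I -> 'rV[R]_d),
    (forall i, S (v i)) /\ x = \sum_i f i *: v i) ->
  affine_hull S = setT.
Proof.
move=> S0 genS; apply/seteqP; split=> // x _ B [aB SB].
have B0 : B 0 by exact: SB.
have BZ t y : B y -> B (t *: y).
  by move=> By; rewrite -[_ *: _]addr0 -(scaler0 _ (1 - t)); apply: aB.
have BD y z : B y -> B z -> B (y + z).
  move=> By Bz; have := aB _ _ 2^-1 (BZ 2 _ By) (BZ 2 _ Bz).
  rewrite !scalerA; have -> : 2^-1 * 2 = 1 :> R by rewrite mulVf.
  by rewrite mulrBl mul1r mulVf // addrK !scale1r.
have [I [f [v [Sv ->]]]] := genS x.
by elim/big_ind: _ => // i _; apply/BZ/SB.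
Qed.

End Convexity.

(** * Simplices with a vertex at the origin *)

Section Simplex.
Context {R : realType} {d : nat} (A : 'M[R]_d).
Hypothesis A_unit : A \in unitmx.

(* Barycentric coordinates for the vertices 0 and [row i A]; the coordinate at
   the vertex 0 is left implicit. *)
Definition bary (y : 'rV[R]_d) (i : 'I_d) : R := (y *m invmx A) 0 i.

Lemma bary0 i : bary 0 i = 0.
Proof. by rewrite /bary mul0mx mxE. Qed.

Lemma baryD x y i : bary (x + y) i = bary x i + bary y i.
Proof. by rewrite /bary mulmxDl mxE. Qed.

Lemma baryZ t y i : bary (t *: y) i = t * bary y i.
Proof. by rewrite /bary -scalemxAl mxE. Qed.

(** The flag [b] treats two cases at once: [true] gives the closed simplex scaled by [t], [false]
    the open one. It keeps this meaning throughout. *)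
Definition simplex (b : bool) (t : R) : set 'rV[R]_d :=
  [set y | (forall i, 0 < bary y i ?<= if b) /\
           \sum_i bary y i < t ?<= if b].

Lemma bary_expansion (y : 'rV[R]_d) :
  y = \sum_i bary y i *: row i A.
Proof. by rewrite -mulmx_sum_row mulmxKV. Qed.

Lemma bary_row i j : bary (row i A) j = (i == j)%:R.
Proof. by rewrite /bary -row_mul mulmxV // !mxE. Qed.

Lemma bary_row_sum i : \sum_j bary (row i A) j = 1.
Proof.
rewrite (bigD1 i) //= bary_row eqxx big1 ?addr0 // => j /negPf ji.
by rewrite bary_row eq_sym ji.
Qed.

Lemma simplex_convex_hull :
  simplex true 1 = convex_hull (0 |` range (fun i => row i A)).
Proof.
apply/seteqP; split=> [y [y0 y1]|].
  rewrite [y]bary_expansion; apply: convex_set_sum => //.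
  - exact: convex_hull_convex.
  - by apply: sub_gen_smallest; left.
  - by move=> i; apply: sub_gen_smallest; right; exists i.
apply: smallest_sub.
  apply/convex_setE => x y t /andP[t0 t1] [x0 x1] [y0 y1]; split=> /= [i|].
    rewrite baryD !baryZ addr_ge0 // mulr_ge0 //.
    - exact: x0.
    - by rewrite subr_ge0.
    - exact: y0.
  under eq_bigr do rewrite baryD !baryZ.
  rewrite big_split -!mulr_sumr /=.
  by rewrite /= in x1 y1; nra.
move=> _ [->|[i _ <-]]; split=> /= [j|].
- by rewrite bary0.
- by rewrite big1 // => j _; exact: bary0.
- by rewrite bary_row ler0n.
- by rewrite bary_row_sum.
Qed.

Lemma simplex_integral_convex_polytope :
  A \is a mxOver Num.int -> integral_convex_polytope (simplex true 1).
Proof.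
move=> /mxOverP Aint; rewrite simplex_convex_hull; split.
  exists (0 |` range (fun i => row i A)) => //.
  rewrite finite_setU; split; first exact: finite_set1.
  exact/finite_image/finite_finset.
move=> v /vertex_convex_hull[->|[i _ <-]]; apply/mxOverP => j k.
  by rewrite mxE rpred0.
by rewrite mxE.
Qed.

Lemma simplex_has_dimension : has_dimension (simplex true 1) d.
Proof.
exists 0, fullv; split; last by rewrite dimvf /dim /= mul1n.
rewrite affine_hull_setT; first last.
- move=> x; exists 'I_d, (fun i => bary x i), (fun i => row i A); split.
    move=> i; rewrite simplex_convex_hull.
    by apply: sub_gen_smallest; right; exists i.
  exact: bary_expansion.
- by rewrite simplex_convex_hull; apply: sub_gen_smallest; left.
by apply/seteqP; split=> // x _; exists x; rewrite ?add0r //= memvf.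
Qed.

Lemma dilate_simplex b n : (0 < n)%N -> dilate n (simplex b 1) = simplex b n%:R.
Proof.
move=> n0; have n0' : 0 < n%:R :> R by rewrite ltr0n.
have scaleE y : simplex b n%:R (n%:R *: y) <-> simplex b 1 y.
  have -> : simplex b n%:R (n%:R *: y) =
      ((forall i, 0 < n%:R * bary y i ?<= if b) /\
      n%:R * \sum_i bary y i < n%:R * 1 ?<= if b).
    rewrite /simplex /= mulr1 mulr_sumr; under eq_bigr do rewrite baryZ.
    by congr (_ /\ _); apply: eq_forall => i; rewrite baryZ.
  rewrite lteif_pM2l //; split=> -[y0 y1]; split=> // i; move: (y0 i).
    by rewrite -{1}(mulr0 n%:R) lteif_pM2l.
  by rewrite -{2}(mulr0 n%:R) lteif_pM2l.
apply/seteqP; split=> [_ [y yA <-]|y yA]; first exact/scaleE.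
exists (n%:R^-1 *: y); last by rewrite scalerA divff ?scale1r // gt_eqF.
by apply/scaleE; rewrite scalerA divff ?scale1r // gt_eqF.
Qed.

Lemma bary_continuous i : continuous (fun y : 'rV[R]_d => bary y i).
Proof.
rewrite /bary; under eq_fun do rewrite mxE.
apply: continuous_bigsum => j y.
have yj := @coord_continuous R 1 d 0 j y.
exact: (cvgMr_tmp (FF := nbhs_filter y) yj).
Qed.

(** Finitely many strict inequalities between continuous functions define an open set. Conversely,
    an interior point can be moved a little in any direction without leaving the simplex, so none of
    its inequalities is an equality. *)
Lemma simplex_interior : (0 < d)%N -> (simplex true 1)° = simplex false 1.
Proof.
move=> d0; apply/seteqP; split=> y; last first.
  move=> [y0 y1]; rewrite /interior.
  have ny i : \forall z \near y, 0 < bary z i.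
    have := @cvgr_gt _ _ _ (nbhs_filter y) _ _ (@bary_continuous i y).
    by apply; exact: y0.
  have ns : \forall z \near y, \sum_i bary z i < 1.
    have : continuous (fun y : 'rV[R]_d => \sum_i bary y i).
      apply: continuous_bigsum => i; exact: bary_continuous.
    move=> /(_ y) /(@cvgr_lt _ _ _ (nbhs_filter y)).
    by apply; exact: y1.
  apply: filterS2 (filter_forall (nbhs_filter y) ny) ns => z z0 z1.
  by split=> /= [i|]; exact/ltW.
move=> yA.
have pushed u : exists2 e : R, 0 < e & simplex true 1 (y + e *: u).
  have : \forall e \near (0 : R), simplex true 1 (y + e *: u).
    have : (y + e *: u) @[e --> (0 : R)] --> y.
      rewrite -[X in _ --> X]addr0 -[X in _ + X](scale0r u).
      by apply: cvgD; [exact: cvg_cst|apply: cvgZr_tmp; exact: cvg_id].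
    by apply; exact: yA.
  move=> /nbhs_ballP[e /= e0 ye]; exists (e / 2); first by rewrite divr_gt0.
  by apply: ye; rewrite /ball /= sub0r normrN gtr0_norm; lra.
split=> /= [i|].
  (* This move lowers the [i]-th barycentric coordinate by [e]. *)
  have [e e0 [/(_ i) + _]] := pushed (- row i A).
  by rewrite -scaleN1r !(baryD, baryZ) bary_row eqxx /=; lra.
(* A move along any row raises the coordinate sum by [e]; [d0] provides a row. *)
have [e e0 [_]] := pushed (row (Ordinal d0) A).
rewrite /=; under eq_bigr do rewrite baryD baryZ.
by rewrite big_split /= -mulr_sumr bary_row_sum; lra.
Qed.

End Simplex.

(** * Cardinalities, block sums and integrality *)

Lemma card_fset_set_image (T U : choiceType) (f : T -> U) (D : set T) :
  finite_set D -> injective f -> #|` fset_set (f @` D)| = #|` fset_set D|.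
Proof. by move=> Dfin f_inj; rewrite fset_set_image // card_imfset. Qed.

Lemma card_fset_setU (T : choiceType) (D E : set T) :
  finite_set D -> finite_set E -> D `&` E = set0 ->
  #|` fset_set (D `|` E)| = (#|` fset_set D| + #|` fset_set E|)%N.
Proof.
move=> Dfin Efin DE; rewrite fset_setU // -cardfsUI -fset_setI //.
by rewrite DE fset_set0 cardfs0 addn0.
Qed.

Lemma sum_blocks (V : pzRingType) (n m p q : nat) (x y z : V) :
  n = (m + p + q)%N ->
  \sum_(i < n) (if (i < m)%N then x else if (i < m + p)%N then y else z) =
  x * m%:R + y * p%:R + z * q%:R.
Proof.
move=> ->; rewrite !big_split_ord /=; congr (_ + _ + _).
- by under eq_bigr do rewrite ltn_ord; rewrite sumr_const card_ord mulr_natr.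
- under eq_bigr do rewrite ltnNge leq_addr /= ltn_add2l ltn_ord.
  by rewrite sumr_const card_ord mulr_natr.
under eq_bigr do rewrite ltnNge -addnA leq_addr /= ltnNge addnA leq_addr /=.
by rewrite sumr_const card_ord mulr_natr.
Qed.

Lemma int_gtN1_ge0 (R : archiRealDomainType) (x : R) :
  x \is a Num.int -> -1 < x -> 0 <= x.
Proof. by move=> /intrP[m ->]; rewrite -[-1]/((-1)%:~R) ltr_int ler0z; lia. Qed.

Lemma int_lt1_le0 (R : archiRealDomainType) (x : R) :
  x \is a Num.int -> x < 1 -> x <= 0.
Proof.
move=> xint x1; rewrite -oppr_ge0; apply: int_gtN1_ge0; first by rewrite rpredN.
by rewrite ltrN2.
Qed.

Lemma finite_lattice_box (R : realType) (d t : nat) (D : set 'rV[R]_d) :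
  (forall x, D x -> integer_points x /\ forall i, 0 <= x 0 i <= t%:R) ->
  finite_set D.
Proof.
move=> Dbox.
pose g (f : {ffun 'I_d -> 'I_t.+1}) : 'rV[R]_d := \row_i (f i)%:R.
apply: (@sub_finite_set _ _ (range g)); last exact/finite_image/finite_finset.
move=> x /Dbox[/mxOverP xint xt].
exists [ffun i => inord (Num.truncn (x 0 i))] => //.
apply/rowP => i; rewrite mxE ffunE; have /andP[x0 xit] := xt i.
have xnat : x 0 i \is a Num.nat by rewrite natrEint xint.
rewrite inordK ?truncnK // ltnS -(ler_nat R) truncnK //.
Qed.

(** * Lattice points of a simplex with one skew vertex *)

Section SkewSimplex.
Context {R : realType} {d : nat} (a : 'I_d -> int) (i0 : 'I_d) (N : nat).
Hypothesis N_gt0 : (0 < N)%N.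

Definition skew_mx : 'M[R]_d := \matrix_(i, j)
  if i == i0 then (if j == i0 then N%:R else (a j)%:~R) else (i == j)%:R.

Lemma mul_skew_mx (x : 'rV[R]_d) j : (x *m skew_mx) 0 j =
  if j == i0 then x 0 i0 * N%:R else x 0 j + x 0 i0 * (a j)%:~R.
Proof.
rewrite mxE (bigD1 i0) //= mxE eqxx; case: eqP => [->|/eqP ji0].
  rewrite big1 ?addr0 // => i /negPf ii0.
  by rewrite mxE ii0 mulr0.
rewrite (bigD1 j) //= mxE (negPf ji0) eqxx mulr1 big1 ?addr0 1?addrC //.
by move=> i /andP[/negPf ii0 /negPf ij]; rewrite mxE ii0 ij mulr0.
Qed.

Let N_neq0 : N%:R != 0 :> R. Proof. by rewrite pnatr_eq0 -lt0n. Qed.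

Lemma skew_mx_unit : skew_mx \in unitmx.
Proof.
rewrite -row_free_unit; apply: inj_row_free => v /rowP v0; apply/rowP => j.
have vi0 : v 0 i0 = 0.
  have := v0 i0; rewrite mul_skew_mx eqxx mxE => /eqP.
  by rewrite mulf_eq0 (negPf N_neq0) orbF => /eqP.
have := v0 j; rewrite mul_skew_mx !mxE; case: eqP => [->//|_].
by rewrite vi0 mul0r addr0.
Qed.

Lemma skew_mx_int : skew_mx \is a mxOver Num.int.
Proof.
apply/mxOverP => i j; rewrite mxE; case: ifP => _; last by rewrite natr_int.
by case: ifP => _; rewrite ?natr_int ?intr_int.
Qed.

Lemma bary_skew_apex y : bary skew_mx y i0 = y 0 i0 / N%:R.
Proof.
apply: (canRL (mulfK N_neq0)).
by rewrite -{2}(mulmxKV skew_mx_unit y) mul_skew_mx eqxx.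
Qed.

Lemma bary_skew y j : j != i0 ->
  bary skew_mx y j = y 0 j - bary skew_mx y i0 * (a j)%:~R.
Proof.
move=> /negPf ji0; apply: (canRL (addrK _)).
by rewrite -{3}(mulmxKV skew_mx_unit y) mul_skew_mx ji0.
Qed.

Lemma bary_mul_skew x j : bary skew_mx (x *m skew_mx) j = x 0 j.
Proof. by rewrite /bary mulmxK // skew_mx_unit. Qed.

Lemma bary_inj y z : bary skew_mx y =1 bary skew_mx z -> y = z.
Proof.
move=> yz; rewrite (bary_expansion skew_mx_unit y).
rewrite (bary_expansion skew_mx_unit z); by apply: eq_bigr => i _; rewrite yz.
Qed.

(** These are the vectors of integral barycentric coordinates; neither [a] nor [N] enters, so their
    number is common to the whole family. *)
Definition standard_lattice b t : set 'rV[R]_d :=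
  [set x | [/\ integer_points x, forall i, 0 < x 0 i ?<= if b
             & \sum_i x 0 i < t%:R ?<= if b]].

(* Lattice points of [t P] that are not in the lattice spanned by the vertices
   of [P]. *)
Definition extra_lattice b t : set 'rV[R]_d :=
  [set y | [/\ simplex skew_mx b t%:R y, integer_points y
             & bary skew_mx y i0 \isn't a Num.int]].

Lemma finite_standard_lattice b t : finite_set (standard_lattice b t).
Proof.
apply: (@finite_lattice_box _ _ t) => x [xint x0 xt]; split=> // i.
have x0' j : 0 <= x 0 j by apply: lteifW (x0 j).
rewrite x0' /=; apply: le_trans (lteifW xt).
by rewrite (bigD1 i) //= lerDl sumr_ge0.
Qed.

(** By [bary_skew], all barycentric coordinates of a lattice point are integers as soon as the one
    at [i0] is. *)
Lemma lattice_decomposition b t :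
  simplex skew_mx b t%:R `&` integer_points =
  mulmx^~ skew_mx @` standard_lattice b t `|` extra_lattice b t.
Proof.
apply/seteqP; split=> [y [yP yint]|y].
  have [bint|nbint] := boolP (bary skew_mx y i0 \is a Num.int); last by right.
  left; exists (y *m invmx skew_mx); last exact: mulmxKV skew_mx_unit y.
  case: yP => y0 yt; split=> //; apply/mxOverP => i j; rewrite ord1.
  have [->//|ji0] := eqVneq j i0.
  move/mxOverP: yint => yint.
  by rewrite -/(bary _ y j) bary_skew // rpredB // rpredM // intr_int.
move=> [[x [xint x0 xt] <-]|[]//]; split; last exact/mxOverM/skew_mx_int.
split=> [i|]; first by rewrite bary_mul_skew.
by under eq_bigr do rewrite bary_mul_skew.
Qed.

Lemma card_simplex_lattice b t : finite_set (extra_lattice b t) ->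
  #|` fset_set (simplex skew_mx b t%:R `&` integer_points)| =
  (#|` fset_set (standard_lattice b t)| + #|` fset_set (extra_lattice b t)|)%N.
Proof.
move=> Efin; have Sfin := finite_standard_lattice b t.
rewrite lattice_decomposition card_fset_setU //.
- rewrite card_fset_set_image // => x y /(congr1 (mulmx^~ (invmx skew_mx))).
  by rewrite /= !mulmxK // skew_mx_unit.
- exact: finite_image.
apply/seteqP; split=> // _ [[x [/mxOverP xint _ _] <-] [_ _]].
by rewrite bary_mul_skew xint.
Qed.

Definition skew_simplex : set 'rV[R]_d := simplex skew_mx true 1.

Lemma skew_simplex_integral : integral_convex_polytope skew_simplex.
Proof. exact: simplex_integral_convex_polytope skew_mx_unit skew_mx_int. Qed.

Lemma skew_simplex_dim : has_dimension skew_simplex d.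
Proof. exact: simplex_has_dimension skew_mx_unit. Qed.

Lemma ehrhart_skew t : (0 < t)%N -> finite_set (extra_lattice true t) ->
  ehrhart skew_simplex t =
  (#|` fset_set (standard_lattice true t)| +
   #|` fset_set (extra_lattice true t)|)%N.
Proof.
by move=> t0 Efin; rewrite -card_simplex_lattice // /ehrhart dilate_simplex.
Qed.

Lemma ehrhart_interior_skew t :
  (0 < t)%N -> finite_set (extra_lattice false t) ->
  ehrhart_interior skew_simplex t =
  (#|` fset_set (standard_lattice false t)| +
   #|` fset_set (extra_lattice false t)|)%N.
Proof.
move=> t0 Efin; rewrite -card_simplex_lattice // /ehrhart_interior.
rewrite setD_boundary simplex_interior ?dilate_simplex ?skew_mx_unit //.
exact: leq_ltn_trans (ltn_ord i0).
Qed.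

End SkewSimplex.

(** * Lattice points outside the vertex lattice *)

Definition skew_coef (d k l : nat) (i : 'I_d) : int :=
  if (i < k)%N then 1 else if (i < k + (d - l))%N then -1 else 0.

Section Family.
Context {R : realType} {d : nat} (k l M : nat) (i0 : 'I_d).
Hypothesis i0k : i0 = k :> nat.
Hypothesis le_kl : (k <= l)%N.
Hypothesis lt_kld : (k + l < d)%N.
Hypothesis M_gt0 : (0 < M)%N.

Let w := (d - l - k)%N.
Let N := (w * M)%N.
Let a : 'I_d -> int := skew_coef k l.
Let c (b : bool) := if b then k else l.

Let N_gt0 : (0 < N)%N. Proof. by rewrite muln_gt0 M_gt0 andbT /w; lia. Qed.

Let d_blocks : d = (k + (d - l) + (l - k))%N. Proof. lia. Qed.

Let w_gt0 : (0 < w)%N. Proof. rewrite /w; lia. Qed.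

Let le_kdl : (k < k + (d - l))%N. Proof. lia. Qed.

Let le_ld : (l <= d)%N. Proof. lia. Qed.

Let le_kd : (k <= d - l)%N. Proof. lia. Qed.

(* The componentwise least barycentric coordinates of a point of the cone over
   the (closed or open) simplex whose coordinate at [i0] is [q] modulo 1. *)
Definition profile b (q : R) (j : 'I_d) : R :=
  if (j < k)%N then 1 - q else if (j < k + (d - l))%N then q else (~~ b)%:R.

(** The [k] entries [1 - q] and the [d - l] entries [q] add up to [k + w q]; in the open case the
    [l - k] entries 1 raise [k] to [l]. *)
Lemma sum_profile b q : \sum_j profile b q j = (c b)%:R + w%:R * q.
Proof.
rewrite (@sum_blocks _ d k (d - l) (l - k)) //.
rewrite /w /c !natrB //.
by case: b => /=; ring.
Qed.

Let wqE r : w%:R * (r%:R / N%:R) = r%:R / M%:R :> R.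
Proof.
have w0 : w%:R != 0 :> R by rewrite pnatr_eq0 -lt0n.
by rewrite /N natrM invfM mulrCA mulVKf.
Qed.

(** This is the product of the vector [profile b (r / N)] with the skew matrix, which makes it
    integral. *)
Definition extra_point b r : 'rV[R]_d := \row_j
  if j == i0 then r%:R
  else if (j < k)%N then 1 else if (j < k + (d - l))%N then 0 else (~~ b)%:R.

Lemma bary_extra_point b r :
  bary (skew_mx a i0 N) (extra_point b r) =1 profile b (r%:R / N%:R).
Proof.
move=> j; have bi0 : bary (skew_mx a i0 N) (extra_point b r) i0 = r%:R / N%:R.
  by rewrite bary_skew_apex // mxE eqxx.
have [->|ji0] := eqVneq j i0.
  by rewrite bi0 /profile i0k ltnn le_kdl.
rewrite bary_skew // bi0 mxE (negPf ji0) /profile /a /skew_coef.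
by case: ifP => _; [|case: ifP => _]; rewrite ?rmorphN ?rmorph1 ?rmorph0; ring.
Qed.

Lemma extra_point_inj b : injective (extra_point b).
Proof.
move=> r s /rowP/(_ i0); rewrite !mxE eqxx => /eqP.
by rewrite eqr_nat => /eqP.
Qed.

(** The bound [r < M + b] reads [r <= M] in the closed case and [r < M] in the open one, matching
    [r / M] against the slack 1 left by the dilation. *)
Lemma extra_point_in (b : bool) r : (0 < r < N)%N -> (r < M + b)%N ->
  extra_lattice a i0 N b (c b).+1 (extra_point b r).
Proof.
move=> /andP[r0 rN] rM; have N0 : 0 < N%:R :> R by rewrite ltr0n.
have q0 : 0 < r%:R / N%:R :> R by rewrite divr_gt0 ?ltr0n.
have q1 : r%:R / N%:R < 1 :> R by rewrite ltr_pdivrMr // mul1r ltr_nat.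
split.
- split=> [i|].
    rewrite bary_extra_point /profile.
    case: ifP => _; first by apply: lteifS; rewrite subr_gt0.
    by case: ifP => _; [exact: lteifS|case: (b) => //=; rewrite ltr01].
  under eq_bigr do rewrite bary_extra_point.
  rewrite sum_profile wqE -natr1 lteifD2l lteif_pdivrMr ?ltr0n // mul1r.
  by case: (b) rM => /=; rewrite ?addn1 ?addn0 ?ltnS ?ler_nat ?ltr_nat.
- apply/mxOverP => i j; rewrite mxE.
  case: ifP => _; first exact: natr_int.
  by case: ifP => _; [|case: ifP => _]; rewrite ?natr_int.
rewrite bary_extra_point /profile i0k ltnn le_kdl; apply/negP.
by move=> /int_lt1_le0/(_ q1); rewrite leNgt q0.
Qed.

Lemma extra_latticeE (b : bool) t y : extra_lattice a i0 N b t y ->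
  (c b < t)%N /\ (t = (c b).+1 ->
    exists r, [/\ (0 < r < N)%N, (r < M + b)%N & y = extra_point b r]).
Proof.
move=> [[y0 yt] /mxOverP yint nbint].
have N0 : 0 < N%:R :> R by rewrite ltr0n.
have y0' i : 0 <= bary (skew_mx a i0 N) y i by apply: lteifW (y0 i).
have /natrP[n yn] : y 0 i0 \is a Num.nat.
  rewrite natrEint yint -(@pmulr_lge0 _ (N%:R)^-1) ?invr_gt0 //.
  rewrite -(bary_skew_apex a i0 N_gt0); exact: y0'.
(* [q] is the fractional part of the barycentric coordinate at [i0]. *)
pose r := (n %% N)%N; pose q : R := r%:R / N%:R.
have bi0 : bary (skew_mx a i0 N) y i0 = (n %/ N)%:R + q.
  rewrite bary_skew_apex // yn {1}(divn_eq n N) natrD natrM mulrDl mulfK //.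
  by rewrite gt_eqF.
have r0 : (0 < r)%N.
  rewrite lt0n; apply: contra nbint => /eqP r0.
  by rewrite bi0 /q r0 mul0r addr0 natr_int.
have rN : (r < N)%N by rewrite ltn_mod.
have q0 : 0 < q by rewrite divr_gt0 ?ltr0n.
have q1 : q < 1 by rewrite ltr_pdivrMr // mul1r ltr_nat.
pose u j := bary (skew_mx a i0 N) y j - profile b q j.
(* Away from [i0], subtracting [q] times 1, -1 or 0 from an integer leaves [-q], [q] or 0 modulo 1,
   as in the profile. *)
have u_int j : u j \is a Num.int.
  rewrite /u; have [->|ji0] := eqVneq j i0.
    by rewrite bi0 /profile i0k ltnn le_kdl addrK natr_int.
  rewrite bary_skew // bi0 /profile /a /skew_coef.
  case: ifP => _; [|case: ifP => _].
  - rewrite (_ : _ - _ = y 0 j - (n %/ N)%:R - 1); last by ring.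
    by rewrite !rpredB // ?natr_int ?rpred1.
  - rewrite (_ : _ - _ = y 0 j + (n %/ N)%:R).
      by rewrite rpredD // natr_int.
    by rewrite rmorphN rmorph1; ring.
  by rewrite rmorph0 mulr0 subr0 rpredB // natr_int.
(* An integer above -1 is nonnegative: the profile is below 1, except for its entries 1 in the open
   case, where the coordinate itself is positive. *)
have u_ge0 j : 0 <= u j.
  apply: int_gtN1_ge0 => //; have := y0 j; have := y0' j; rewrite /u /profile.
  move: (bary _ y j) => yj.
  case: ifP => _; [|case: ifP => _]; try lra.
  by case: (b) => /= *; lra.
have sumE : \sum_j bary (skew_mx a i0 N) y j =
    (c b)%:R + r%:R / M%:R + \sum_j u j.
  rewrite -wqE -sum_profile -big_split /=.
  by apply: eq_bigr => j _; rewrite /u addrC subrK.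
have su0 : 0 <= \sum_j u j by apply: sumr_ge0.
have rM0 : 0 < r%:R / M%:R :> R by rewrite divr_gt0 ?ltr0n.
move: yt; rewrite sumE => yt; split.
  by rewrite -(ltr_nat R); have := lteifW yt; lra.
move=> tE; rewrite tE -natr1 in yt; exists r; rewrite r0 rN; split=> //.
  have : r%:R / M%:R < (1 : R) ?<= if b.
    by case: (b) yt => /= yt; lra.
  rewrite lteif_pdivrMr ?ltr0n // mul1r.
  by case: (b) => /=; rewrite ?addn1 ?addn0 ?ltnS ?ler_nat ?ltr_nat.
(* At this dilation the positive term [r / M] leaves less than 1 for the sum of the nonnegative
   integers [u j]. *)
have u0 j : u j = 0.
  apply: le_anti; rewrite u_ge0 andbT; apply: int_lt1_le0 => //.
  have : u j <= \sum_j u j by rewrite (bigD1 j) //= lerDl sumr_ge0.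
  by have := lteifW yt; lra.
apply: (@bary_inj _ _ a i0 N) => // j.
by apply/eqP; rewrite bary_extra_point -subr_eq0 -/q -/(u j) u0.
Qed.

Lemma extra_lattice0 b t :
  (t <= c b)%N -> extra_lattice a i0 N b t = set0 :> set 'rV[R]_d.
Proof.
move=> tc; apply/seteqP; split=> // y /extra_latticeE[+ _].
by rewrite ltnNge tc.
Qed.

End Family.

(** * The infinite family and its counts *)

Theorem theorem0p3 (R : realType) (d k l : nat) (d_ge1 : (1 <= d)%N)
    (le_kl : (k <= l)%N) (le_l : (l%:Z <= d%:Z - k%:Z - 1)) :
  exists P : nat -> set 'rV[R]_d,
    (forall i, integral_convex_polytope (P i) /\ has_dimension (P i) d) /\
    (forall i j, i <> j ->
      [/\ forall t, (1 <= t <= k)%N -> ehrhart (P i) t = ehrhart (P j) t,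
          forall t, (1 <= t <= l)%N ->
            ehrhart_interior (P i) t = ehrhart_interior (P j) t,
          ehrhart (P i) k.+1 <> ehrhart (P j) k.+1
        & ehrhart_interior (P i) l.+1 <> ehrhart_interior (P j) l.+1]).
Proof.
have lt_kld : (k + l < d)%N by lia.
have lt_kd : (k < d)%N by lia.
pose w := (d - l - k)%N; pose i0 := Ordinal lt_kd.
have i0k : i0 = k :> nat by [].
pose a : 'I_d -> int := skew_coef k l.
have N_gt0 i : (0 < w * i.+1)%N by rewrite muln_gt0 andbT /w; lia.
have ext0 b i t : (t <= if b then k else l)%N ->
    extra_lattice a i0 (w * i.+1) b t = set0 :> set 'rV[R]_d.
  exact: extra_lattice0.
(* With [M = i + 1], the residues [r] from 1 to [i] always occur; [r = i + 1] occurs only in the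
   closed case, and only if it is below [N = w (i + 1)], that is, if [w > 1]. *)
pose m (b : bool) i := (i + (b && (1 < w)))%N.
have extS b i : extra_lattice a i0 (w * i.+1) b (if b then k else l).+1 =
    (fun r => extra_point k l i0 b r.+1) @` `I_(m b i) :> set 'rV[R]_d.
  apply/seteqP; split=> [y|_ [r /= rm <-]].
    move=> /(extra_latticeE i0k le_kl lt_kld (ltn0Sn i))[_ /(_ erefl)].
    move=> [[|r] [/andP[r0 rN] rM ->]] //; exists r => //=.
    rewrite /m; rewrite -/w in rN; case: (b) rM => /= rM; last by lia.
    by case: (ltnP 1 w) => w1 /=; nia.
  apply: (extra_point_in i0k le_kl lt_kld (ltn0Sn i)); rewrite -/w.
    have := N_gt0 i; rewrite /m in rm; case: (ltnP 1 w) rm => w1; nia.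
  by rewrite /m in rm; case: (b) rm => /=; lia.
have fin0 b i t : (t <= if b then k else l)%N ->
    finite_set (extra_lattice a i0 (w * i.+1) b t : set 'rV[R]_d).
  by move=> /ext0 ->.
have finS b i :
    finite_set (extra_lattice a i0 (w * i.+1) b
      (if b then k else l).+1 : set 'rV[R]_d).
  by rewrite extS; exact/finite_image/finite_II.
have cardS b i : #|` fset_set (extra_lattice a i0 (w * i.+1) b
    (if b then k else l).+1 : set 'rV[R]_d)| = m b i.
  rewrite extS card_fset_set_image; last 2 first.
  - exact: finite_II.
  - by move=> r s /extra_point_inj [].
  exact: card_fset_set (card_eqxx _).
exists (fun i => skew_simplex a i0 (w * i.+1)); split=> [i|i j ij].
  by split; [exact: skew_simplex_integral|exact: skew_simplex_dim].
split=> [t /andP[t0 tk]|t /andP[t0 tl]||].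
- by rewrite !ehrhart_skew ?(fin0 true) // !(ext0 true).
- by rewrite !ehrhart_interior_skew ?(fin0 false) // !(ext0 false).
(* The standard counts cancel, and [m b] is injective in the index. *)
- rewrite !ehrhart_skew ?(finS true) // !(cardS true) => /addnI/addIn.
  exact: ij.
- rewrite !ehrhart_interior_skew ?(finS false) // !(cardS false).
  by move=> /addnI/addIn; exact: ij.
Qed.
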